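(* The following two assertions are equivalent: (A) For every family $(R_i)_{i\in I}$ of subrings of $\mathbb{Q}$, each finitely generated over $\mathbb{Z}$, with $R = \varinjlim_{i \in I} R_i \subseteq \mathbb{Q}$, every positive integer $n$ and every $f \in \mathbb{Z}[x_1,\dots,x_n]^n$: if $\det(Jf) \in R^\times$ and the induced map $f \colon (R/pR)^n \to (R/pR)^n$ is bijective for every prime number $p$ not meeting $S$ (where $R = S^{-1}\mathbb{Z}$), then $f \colon R^n \to R^n$ is invertible over $R$. (B) (Jacobian conjecture over $\mathbb{Q}$) For every positive integer $n$ and every $f \in \mathbb{Q}[x_1,\dots,x_n]^n$ with $\det(Jf) \in \mathbb{Q}^\times$, the polynomial map $f \colon \mathbb{Q}^n \to \mathbb{Q}^n$ is invertible over $\mathbb{Q}$.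
   Context: All rings are commutative with unity. The direct limit $R = \varinjlim_{i\in I} R_i$ of the subrings $R_i \subseteq \mathbb{Q}$ is the subring of $\mathbb{Q}$ generated by all the $R_i$ (their union if the family is directed by inclusion). Every subring $R$ of $\mathbb{Q}$ can be written as $R = S^{-1}\mathbb{Z}$ for a multiplicatively closed set $S \subseteq \mathbb{Z}\setminus\{0\}$; a prime number $p$ does not meet $S$ if $p\mathbb{Z} \cap S = \emptyset$ (equivalently, $p$ is not a unit in $R$). For a ring $R$, $f = (f_1,\dots,f_n) \in R[x]^n$ with $x=(x_1,\dots,x_n)$, and an $R$-algebra $T$, the polynomial map $f \colon T^n \to T^n$ is $a \mapsto (f_1(a),\dots,f_n(a))$. It is called invertible over $T$ if $T[f_1,\dots,f_n] = T[x]$, equivalently if there exists $g \in T[x]^n$ with $f(g(x)) = g(f(x)) = x$. $Jf = (\partial f_i/\partial x_j)_{i,j}$ is the Jacobian matrix; $\det(Jf) \in R^\times$ means that $\det(Jf)$ is a constant polynomial which is a unit of $R$. *)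

(* Defs.v *)
From HB Require Import structures.
From mathcomp Require Import all_boot all_order all_algebra.
From mathcomp Require Import ring_quotient.
From mathcomp Require Import boolp.
From mathcomp Require Import mpoly.

Set Implicit Arguments.
Unset Strict Implicit.
Unset Printing Implicit Defensive.

Import GRing.Theory Num.Theory.

Local Open Scope ring_scope.

(* [subringClosed rat] is a bool-valued predicate; since the generated subring
   is defined by a Prop, it goes through [asbool]. *)
Definition subring_gen (A : rat -> Prop) : {pred rat} :=
  fun x => `[< forall U : subringClosed rat,
                 (forall y, A y -> y \in U) -> x \in U >].

Lemma subring_gen_closed (A : rat -> Prop) : subring_closed (subring_gen A).
Proof.
split; first by apply/asboolP => U _; exact: rpred1.
- move=> x y /asboolP Ax /asboolP Ay; apply/asboolP => U AU.
  by apply: rpredB; [exact: Ax | exact: Ay].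
- move=> x y /asboolP Ax /asboolP Ay; apply/asboolP => U AU.
  by apply: rpredM; [exact: Ax | exact: Ay].
Qed.

HB.instance Definition _ (A : rat -> Prop) :=
  GRing.isSubringClosed.Build rat (subring_gen A) (subring_gen_closed A).

Definition finitely_generated (R : subringClosed rat) : Prop :=
  exists s : seq rat, R =i subring_gen (fun x => x \in s).

(* The family need not be directed: the limit is the subring generated by its
   members, which is their union in the directed case. *)
Definition direct_limit (I : Type) (R_ : I -> subringClosed rat) :
    subringClosed rat :=
  subring_gen (fun x => exists i, x \in R_ i).

Definition subring_of (R : subringClosed rat) := {x : rat | x \in R}.

HB.instance Definition _ (R : subringClosed rat) :=
  SubChoice.on (subring_of R).
HB.instance Definition _ (R : subringClosed rat) :=
  [SubChoice_isSubComNzRing of subring_of R by <:].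

Definition mult_closed (S : int -> Prop) : Prop :=
  [/\ S 1, ~ S 0 & forall s t, S s -> S t -> S (s * t)].

Definition is_localization (R : subringClosed rat) (S : int -> Prop) : Prop :=
  forall x : rat,
    x \in R <-> exists a s : int, S s /\ x = a%:~R / s%:~R.

Definition meets (p : nat) (S : int -> Prop) : Prop :=
  exists a : int, S (p%:Z * a).

Definition pideal (R : subringClosed rat) (p : nat) : {pred subring_of R} :=
  fun x => `[< exists y : subring_of R, x = p%:R * y >].

Arguments pideal : clear implicits.

Lemma pideal_proper (R : subringClosed rat) (S : int -> Prop) (p : nat) :
  mult_closed S -> is_localization R S -> ~ meets p S ->
  1 \notin pideal R p.
Proof.
move=> [_ S0 _] RS pS; apply/negP => /asboolP [y] /(congr1 val) ye.
have {ye} E : 1 = p%:R * (val y : rat).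
  by rewrite rmorphM rmorph_nat rmorph1 in ye.
have /RS [a [s [Ss ys]]] : (val y : rat) \in R by exact: valP y.
have s0 : (s%:~R : rat) != 0.
  by rewrite intr_eq0; apply/eqP => s0; apply: S0; rewrite -s0.
apply: pS; exists a; suff -> : p%:Z * a = s by [].
apply: (@intr_inj rat); rewrite rmorphM /=.
have -> : a%:~R = s%:~R * val y :> rat by rewrite ys mulrC divfK.
by rewrite mulrCA -E mulr1.
Qed.

Lemma pideal_closed (R : subringClosed rat) (p : nat) :
  1 \notin pideal R p -> idealr_closed (pideal R p).
Proof.
move=> p1; split=> //; first by apply/asboolP; exists 0; rewrite mulr0.
move=> a u v /asboolP [u' ->] /asboolP [v' ->]; apply/asboolP.
by exists (a * u' + v'); rewrite mulrDr mulrCA.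
Qed.

Definition pidealr (R : subringClosed rat) (p : nat)
    (p1 : 1 \notin pideal R p) : idealr (subring_of R) :=
  HB.pack (pideal R p) (isIdealr.Build _ (pideal R p) (pideal_closed p1)).

(* R/pR; the library's quotient rings are nontrivial, hence the proof that pR
   is proper, which holds when p does not meet S. *)
Definition residue_ring (R : subringClosed rat) (p : nat)
    (p1 : 1 \notin pideal R p) : comNzRingType :=
  {ideal_quot (pidealr p1)}.

Definition base_change (T : comNzRingType) (n : nat) (f : n.-tuple {mpoly int[n]}) :
    n.-tuple {mpoly T[n]} :=
  [tuple map_mpoly (intmul (1 : T)) (tnth f i) | i < n].

Definition poly_map (T : comNzRingType) (n : nat)
    (f : n.-tuple {mpoly T[n]}) (a : n.-tuple T) : n.-tuple T :=
  [tuple (tnth f i).@[tnth a] | i < n].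

(* T[f_1, ..., f_n] = T[x_1, ..., x_n] *)
Definition invertible (T : comNzRingType) (n : nat)
    (f : n.-tuple {mpoly T[n]}) : Prop :=
  forall h : {mpoly T[n]}, exists q : {mpoly T[n]}, q \mPo f = h.

Definition jacobian (T : comNzRingType) (n : nat)
    (f : n.-tuple {mpoly T[n]}) : 'M[{mpoly T[n]}]_n :=
  \matrix_(i, j) (tnth f i)^`M(j).

Definition unit_jacobian_det (T : comNzRingType) (n : nat)
    (f : n.-tuple {mpoly T[n]}) : Prop :=
  exists u v : T, u * v = 1 /\ \det (jacobian f) = u%:MP_[n].

(* Main.v *)
Require Import Defs.
From HB Require Import structures.
From mathcomp Require Import all_boot all_order all_algebra.
From mathcomp Require Import ring_quotient.
From mathcomp Require Import boolp.
From mathcomp Require Import ring.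
From mathcomp Require Import mpoly.

Set Implicit Arguments.
Unset Strict Implicit.
Unset Printing Implicit Defensive.

Import GRing.Theory Num.Theory.

Local Open Scope ring_scope.

(** The implication from the rational Jacobian conjecture rests on one fact:
    for an integral map [f] whose Jacobian determinant is a nonzero constant
    [d], the only denominators that can occur in a polynomial inverse of [f]
    over the rationals are divisors of powers of [d].

    To see it, suppose [q \mPo f = N h] with [q], [h] integral, and let [p] be
    a prime factor of [N]. If [p] divides [d], multiplying by [d / p] trades
    [p] for a factor [d] on the right. Otherwise [f] modulo [p] has a nonzero
    Jacobian determinant over 'F_p, so its components are algebraically
    independent ([jacobian_indep]); as [q \mPo f] vanishes modulo [p], so does
    [q], and [p] cancels on both sides. Repeating this removes [N]
    ([comp_mpoly_denominator]).

    Independence in characteristic [p] is the usual Jacobian criterion: by the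
    chain rule, the partial derivatives of a relation of least degree are again
    relations, hence zero; over 'F_p the relation is then a [p]-th power, whose
    root is a relation of smaller degree.

    Now let [f] be integral
    with Jacobian determinant a unit of a subring [R]. Then [f] is invertible
    over the rationals by the conjecture, and its inverse has coefficients in
    [R] because [d] is a unit there ([invertible_of_rat]).

    Conversely, the rationals are themselves the direct limit of the subrings
    generated by one rational number, and are the localization of the integers
    at all nonzero elements, which every prime meets; so the condition on
    residue rings is vacuous. A rational map becomes integral after
    multiplication by a common denominator, which affects neither its
    invertibility nor the invertibility of its Jacobian determinant
    ([invertible_descale], [unit_jacobian_det_scaled]). *)

(** ** Substitution and the chain rule *)

(** Identities between ring morphisms or derivations need only be checked on
    constants and variables. *)
Lemma mpoly_alg_ind (T : comNzRingType) n (P : {mpoly T[n]} -> Prop) :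
    (forall c, P c%:MP) -> (forall i, P 'X_i) ->
    (forall p q, P p -> P q -> P (p + q)) ->
    (forall p q, P p -> P q -> P (p * q)) ->
  forall p, P p.
Proof.
move=> PC PX PD PM p; rewrite [p]mpolyE.
apply: (big_ind P) => // [|m _]; first by rewrite -mpolyC0; exact: PC.
rewrite -mul_mpolyC mpolyXE_id; apply: (PM) => //.
apply: (big_ind P) => // [|i _]; first by rewrite -mpolyC1; exact: PC.
elim: (m i) => [|k IH]; first by rewrite expr0 -mpolyC1; exact: PC.
by rewrite exprS; exact: PM.
Qed.

Lemma comp_mpolyXi (T : comNzRingType) n k (f : n.-tuple {mpoly T[k]}) i :
  'X_i \mPo f = tnth f i.
Proof. by rewrite comp_mpolyXU -tnth_nth. Qed.

Lemma comp_mpolyA (T : comNzRingType) n k l (f : n.-tuple {mpoly T[k]})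
    (g : k.-tuple {mpoly T[l]}) (q : {mpoly T[n]}) :
  (q \mPo f) \mPo g = q \mPo [tuple tnth f i \mPo g | i < n].
Proof.
elim/mpoly_alg_ind: q => [c|i|p q IHp IHq|p q IHp IHq].
- by rewrite !comp_mpolyC.
- by rewrite !comp_mpolyXi tnth_mktuple.
- by rewrite !comp_mpolyD IHp IHq.
- by rewrite !rmorphM /= IHp IHq.
Qed.

Lemma mderiv_comp_mpoly (T : comNzRingType) n (f : n.-tuple {mpoly T[n]}) j
    (q : {mpoly T[n]}) :
  (q \mPo f)^`M(j) = \sum_i (q^`M(i) \mPo f) * (tnth f i)^`M(j).
Proof.
elim/mpoly_alg_ind: q => [c|i|p q IHp IHq|p q IHp IHq].
- rewrite comp_mpolyC mderivC big1 // => i _.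
  by rewrite mderivC comp_mpoly0 mul0r.
- rewrite comp_mpolyXi (bigD1 i) //= big1 => [|k ki].
    by rewrite mderivX mnm1E eqxx scale1r -[X in (X - _)%MM]add0m addmK mpolyX0
      comp_mpoly1 mul1r addr0.
  by rewrite mderivX mnm1E eq_sym (negPf ki) scale0r comp_mpoly0 mul0r.
- rewrite comp_mpolyD mderivD IHp IHq -big_split /=; apply: eq_bigr => i _.
  by rewrite mderivD comp_mpolyD mulrDl.
- rewrite rmorphM /= mderivM IHp IHq mulr_suml mulr_sumr -big_split /=.
  apply: eq_bigr => i _; rewrite mderivM comp_mpolyD !rmorphM /= mulrDl.
  by rewrite mulrAC mulrA.
Qed.

(** The image of substitution by [f] is a subalgebra, so it is everything as
    soon as it contains the variables. *)
Lemma invertible_variables (T : comNzRingType) n (f : n.-tuple {mpoly T[n]}) :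
  (forall i, exists q, q \mPo f = 'X_i) -> invertible f.
Proof.
move=> /fin_all_exists [g gf] h; exists (h \mPo [tuple g i | i < n]).
rewrite comp_mpolyA -[RHS]comp_mpoly_id; congr (_ \mPo _).
by apply: eq_from_tnth => i; rewrite !tnth_mktuple.
Qed.

(** ** Change of coefficients *)

(** [base_change T f] is the instance at the canonical map from the
    integers. *)
Definition map_polys (A B : comNzRingType) (phi : A -> B) n
    (f : n.-tuple {mpoly A[n]}) : n.-tuple {mpoly B[n]} :=
  [tuple map_mpoly phi (tnth f i) | i < n].

Lemma map_mpoly_inj (A B : comNzRingType) (phi : {rmorphism A -> B}) n :
  injective phi -> injective (map_mpoly phi : {mpoly A[n]} -> {mpoly B[n]}).
Proof.
move=> inj p q /mpolyP pq; apply/mpolyP => m.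
by have := pq m; rewrite !mcoeff_map_mpoly => /inj.
Qed.

Lemma map_mpolyX_id (A B : comNzRingType) (phi : {rmorphism A -> B}) n
    (m : 'X_{1..n}) : map_mpoly phi 'X_[A, m] = 'X_[B, m].
Proof. exact: map_mpolyX. Qed.

Lemma map_mpoly_intr (A B : comNzRingType) (phi : {rmorphism A -> B}) n
    (p : {mpoly int[n]}) :
  map_mpoly phi (map_mpoly (intmul 1) p) = map_mpoly (intmul 1) p.
Proof. by apply/mpolyP => m; rewrite !mcoeff_map_mpoly /= rmorph_int. Qed.

Lemma map_polys_intr (A B : comNzRingType) (phi : {rmorphism A -> B}) n
    (f : n.-tuple {mpoly int[n]}) :
  map_polys phi (base_change A f) = base_change B f.
Proof.
by apply: eq_from_tnth => i; rewrite !tnth_mktuple map_mpoly_intr.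
Qed.

(** Unlike [map_mpoly_comp], this allows a non-injective morphism, as needed
    for reduction modulo a prime. *)
Lemma map_comp_mpoly (A B : comNzRingType) (phi : {rmorphism A -> B}) n
    (f : n.-tuple {mpoly A[n]}) (q : {mpoly A[n]}) :
  map_mpoly phi (q \mPo f) = map_mpoly phi q \mPo map_polys phi f.
Proof.
elim/mpoly_alg_ind: q => [c|i|p q IHp IHq|p q IHp IHq].
- by rewrite map_mpolyC !comp_mpolyC map_mpolyC.
- by rewrite map_mpolyX_id !comp_mpolyXi tnth_mktuple.
- by rewrite !raddfD /= IHp IHq.
- by rewrite !rmorphM /= IHp IHq.
Qed.

Lemma det_jacobian_map (A B : comNzRingType) (phi : {rmorphism A -> B}) n
    (f : n.-tuple {mpoly A[n]}) :
  \det (jacobian (map_polys phi f)) = map_mpoly phi (\det (jacobian f)).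
Proof.
rewrite -det_map_mx; congr (\det _); apply/matrixP => i j; rewrite !mxE.
rewrite tnth_mktuple; apply/mpolyP => m.
by rewrite mcoeff_deriv !mcoeff_map_mpoly /= mcoeff_deriv rmorphMn.
Qed.

(** ** Algebraic independence modulo a prime *)

Lemma msize_mderiv_lt (T : comNzRingType) n (q : {mpoly T[n]}) i :
  (0 < msize q)%N -> (msize q^`M(i) < msize q)%N.
Proof.
move=> q_gt0; rewrite -[X in (_ < X)%N](prednK q_gt0) ltnS msizeE.
apply/bigmax_leqP_seq => m; rewrite mcoeff_msupp mcoeff_deriv => mi _.
have /msize_mdeg_lt : (m + U_(i))%MM \in msupp q.
  by rewrite mcoeff_msupp; apply: contraNneq mi => ->; rewrite mul0rn.
by rewrite mdegD mdeg1 addn1 => lt_mq; rewrite -ltnS prednK.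
Qed.

Lemma msize_exp (K : idomainType) n (q : {mpoly K[n]}) k : q != 0 ->
  (msize (q ^+ k)).-1 = ((msize q).-1 * k)%N.
Proof.
move=> q0; elim: k => [|k IH]; first by rewrite expr0 msize1 muln0.
rewrite exprS msizeM ?expf_neq0 // mulnS -IH.
have : (0 < msize (q ^+ k))%N by rewrite lt0n msize_poly_eq0 expf_neq0.
have : (0 < msize q)%N by rewrite lt0n msize_poly_eq0.
by case: (msize q) => // a _; case: (msize (q ^+ k)) => // b _; rewrite addnS.
Qed.

(** Vanishing derivatives force every exponent in the support to be divisible
    by [p]; since Frobenius fixes the coefficients, dividing all the exponents
    by [p] gives the root. *)
Lemma mderiv0_pth_power n p (q : {mpoly 'F_p[n]}) : prime p ->
  (forall i, q^`M(i) = 0) -> exists r, q = r ^+ p.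
Proof.
move=> p_pr dq0.
have chF : p \in [pchar 'F_p] by exact: pchar_Fp.
have chP : p \in [pchar {mpoly 'F_p[n]}].
  by rewrite inE p_pr /= -mpolyC_nat pcharf0.
(* The coefficient of the derivative at [m - U_(i)] is [m i] times that of
   [q] at [m]. *)
have dvd_supp m i : m \in msupp q -> (p %| m i)%N.
  rewrite mcoeff_msupp => qm.
  case mi : (m i) => [|k]; first by rewrite dvdn0.
  have /mpolyP /(_ (m - U_(i))%MM) := dq0 i.
  have le_im : (U_(i) <= m)%MM by rewrite lep1mP mi.
  rewrite mcoeff_deriv mcoeff0 submK // mnmBE mnm1E eqxx mi subn1 /=.
  rewrite -mulr_natr => /eqP; rewrite mulf_eq0 (negPf qm) /=.
  by rewrite (dvdn_pcharf chF).
exists (\sum_(m <- msupp q) q@_m *: 'X_[[multinom (m i %/ p)%N | i < n]]).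
rewrite -(pFrobenius_autE chP) raddf_sum [LHS]mpolyE /=.
rewrite !big_seq; apply: eq_bigr => m mq.
rewrite pFrobenius_autE exprZn mpolyXn.
rewrite -{2}[q@_m]natr_Zp -(pFrobenius_autE chF) pFrobenius_aut_nat natr_Zp.
congr (_ *: 'X_[_]); apply/mnmP => i.
by rewrite mulmnE mnmE divnK ?dvd_supp.
Qed.

(** The Jacobian criterion, by induction on the degree of a relation [q]: the
    chain rule makes the vector of the [q^`M(i) \mPo f] a kernel vector of the
    Jacobian matrix, so each derivative of [q] is a smaller relation and
    vanishes. A nonconstant [q] is then a [p]-th power, and its root is a
    smaller relation as well. *)
Lemma jacobian_indep n p (f : n.-tuple {mpoly 'F_p[n]}) : prime p ->
  \det (jacobian f) != 0 -> forall q, q \mPo f = 0 -> q = 0.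
Proof.
move=> p_pr det0 q; move: {2}(msize q) (leqnn (msize q)) => k.
elim: k q => [|k IH] q qk qf0.
  by apply/eqP; rewrite -msize_poly_eq0 -leqn0.
have [q1|q1] := leqP (msize q) 1.
  by rewrite (msize1_polyC q1) comp_mpolyC in qf0 *.
have dq0 i : q^`M(i) = 0.
  apply: IH.
    by rewrite -ltnS (leq_trans _ qk) // msize_mderiv_lt // ltnW.
  pose v := \row_i (q^`M(i) \mPo f).
  have vJ : v *m jacobian f = 0.
    apply/rowP => j; rewrite !mxE -[RHS](mderiv0 _ j).
    rewrite -[in RHS]qf0 mderiv_comp_mpoly.
    by apply: eq_bigr => l _; rewrite !mxE.
  have : v *m (jacobian f *m \adj (jacobian f)) = 0.
    by rewrite mulmxA vJ mul0mx.
  rewrite mul_mx_adj mul_mx_scalar => /rowP /(_ i); rewrite !mxE => /eqP.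
  by rewrite mulf_eq0 (negPf det0) => /eqP.
have [r qr] := mderiv0_pth_power p_pr dq0.
have r0 : r != 0.
  by apply: contraTneq q1 => r0; rewrite qr r0 expr0n eqn0Ngt prime_gt0 ?msize0.
suff : r = 0 by move=> /eqP; rewrite (negPf r0).
apply: IH.
  have := msize_exp p r0; rewrite -qr; move: q1 qk (prime_gt1 p_pr).
  case: (msize q) => [|[|a]] //= _ ak; case: (msize r) => [|b] //= p1 aE.
  rewrite !ltnS in ak *; apply: leq_trans ak; rewrite aE.
  have: (0 < b)%N by case: b aE.
  by move=> b0; rewrite -[X in (X < _)%N]muln1 ltn_pmul2l.
apply/eqP; move: qf0; rewrite qr rmorphXn /= => /eqP.
by rewrite expf_eq0 => /andP [].
Qed.

(** ** Denominators of the inverse *)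

Lemma int_dvd_poly n (p : nat) (q : {mpoly int[n]}) : prime p ->
  map_mpoly (intmul (1 : 'F_p)) q = 0 -> exists q', q = p%:Z *: q'.
Proof.
move=> p_pr q0; exists (\sum_(m <- msupp q) (q@_m %/ p)%Z *: 'X_[m]).
rewrite scaler_sumr [LHS]mpolyE; apply: eq_bigr => m _.
rewrite scalerA mulrC divzK // (dvdz_pcharf (pchar_Fp p_pr)).
by have /mpolyP /(_ m) := q0; rewrite mcoeff_map_mpoly mcoeff0 /= => ->.
Qed.

Lemma mpoly_scaleI (K : idomainType) n (c : K) : c != 0 ->
  injective (fun q : {mpoly K[n]} => c *: q).
Proof.
move=> c0 q r /= /mpolyP qr; apply/mpolyP => m.
by have := qr m; rewrite !mcoeffZ => /(mulfI c0).
Qed.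

(** Prime factors of [N] are removed one at a time: those dividing [d] are
    absorbed into a power of [d], and the others divide [q] by independence
    modulo [p]. *)
Lemma comp_mpoly_denominator n (f : n.-tuple {mpoly int[n]}) (d : int) :
    \det (jacobian f) = d%:MP ->
  forall (N : nat) (q h : {mpoly int[n]}), (0 < N)%N ->
    q \mPo f = N%:Z *: h -> exists k q', q' \mPo f = d ^+ k *: h.
Proof.
move=> det_f N; elim/ltn_ind: N => N IH q h N0 qf.
have [N1|N1] := leqP N 1.
  exists 0%N, q; rewrite qf expr0; congr (_%:Z *: _).
  by apply/eqP; rewrite eqn_leq N1.
have p_pr := pdiv_prime N1; set p := pdiv N in p_pr.
have [M NE] : exists M, N = (p * M)%N.
  by exists (N %/ p)%N; rewrite mulnC divnK // pdiv_dvd.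
have M0 : (0 < M)%N by move: N0; rewrite NE muln_gt0 => /andP [].
have MN : (M < N)%N by rewrite NE ltn_Pmull // prime_gt1.
have p0 : p%:Z != 0 by rewrite eqz_nat -lt0n prime_gt0.
have [/dvdzP [d' dE]|pd] := boolP (p%:Z %| d)%Z.
  have /(IH _ MN _ _ M0) [k [q' q'f]] : (d' *: q) \mPo f = M%:Z *: (d *: h).
    by rewrite comp_mpolyZ qf !scalerA dE NE PoszM; congr (_ *: _); ring.
  by exists k.+1, q'; rewrite q'f scalerA exprSr.
have [q' qE] : exists q', q = p%:Z *: q'.
  apply: (int_dvd_poly p_pr).
  apply: (jacobian_indep (f := base_change 'F_p f) p_pr).
    rewrite (det_jacobian_map (intmul 1)) det_f map_mpolyC mpolyC_eq0.
    by rewrite /= -(dvdz_pcharf (pchar_Fp p_pr)).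
  rewrite -(map_comp_mpoly (intmul 1)) qf map_mpolyZ NE PoszM rmorphM /=.
  by rewrite -[p%:~R]/(p%:R) (pcharf0 (pchar_Fp p_pr)) mul0r scale0r.
apply: (IH _ MN q' h M0); apply: (mpoly_scaleI p0).
by rewrite /= -comp_mpolyZ -qE qf scalerA NE PoszM.
Qed.

Lemma clear_denominators n (q : {mpoly rat[n]}) :
  exists (N : nat) (r : {mpoly int[n]}),
    (0 < N)%N /\ map_mpoly intr r = N%:R *: q.
Proof.
elim/mpolyind: q => [|c m q _ _ [N [r [N0 rE]]]].
  by exists 1%N, 0; rewrite raddf0 scaler0.
exists (`|denq c| * N)%N, ((numq c * N%:Z) *: 'X_[m] + denq c *: r).
split; first by rewrite muln_gt0 absz_gt0 denq_neq0.
rewrite raddfD /= !map_mpolyZ /= map_mpolyX_id rE.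
rewrite scalerDr !scalerA natrM natr_absz (gtr0_norm (denq_gt0 c)) rmorphM /=.
by congr (_ *: _ + _); rewrite numqE; ring.
Qed.

Lemma clear_denominators_tuple n (f : n.-tuple {mpoly rat[n]}) :
  exists (N : nat) (g : n.-tuple {mpoly int[n]}),
    (0 < N)%N /\ forall i, map_mpoly intr (tnth g i) = N%:R *: tnth f i.
Proof.
have /fin_all_exists [N /fin_all_exists [r rE]] i :=
  clear_denominators (tnth f i).
exists (\prod_i N i)%N, [tuple (\prod_(j | j != i) N j)%N%:Z *: r i | i < n].
split; first by apply: prodn_cond_gt0 => i _; case: (rE i).
move=> i; have [_ riE] := rE i; rewrite tnth_mktuple map_mpolyZ riE scalerA.
by rewrite [in RHS](bigD1 i) //= mulnC natrM.
Qed.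

(** A ring containing the integers detects that the determinant is constant,
    and then the constant is an integer. *)
Lemma det_jacobian_int (T : comNzRingType) n (f : n.-tuple {mpoly int[n]}) u :
    injective (intmul (1 : T)) ->
    \det (jacobian (base_change T f)) = u%:MP ->
  exists2 d, \det (jacobian f) = d%:MP & u = d%:~R.
Proof.
move=> inj; rewrite (det_jacobian_map (intmul 1)) => det_f.
set D := \det _ in det_f *; exists D@_0.
  apply: (map_mpoly_inj (phi := intmul (1 : T))) => //.
  rewrite det_f map_mpolyC; congr _%:MP.
  have /mpolyP /(_ 0%MM) := det_f.
  by rewrite mcoeff_map_mpoly mcoeffC eqxx mulr1.
have /mpolyP /(_ 0%MM) := det_f.
by rewrite mcoeff_map_mpoly mcoeffC eqxx mulr1.
Qed.

Lemma subring_of_intr_inj (R : subringClosed rat) :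
  injective (intmul (1 : subring_of R)).
Proof.
move=> a b /(congr1 val); rewrite !rmorph_int; exact: intr_inj.
Qed.

Lemma unit_jacobian_det_rat (T : comNzRingType) n
    (f : n.-tuple {mpoly int[n]}) :
    injective (intmul (1 : T)) ->
  unit_jacobian_det (base_change T f) -> unit_jacobian_det (base_change rat f).
Proof.
move=> inj [u [v [uv /(det_jacobian_int inj) [d det_f uE]]]].
have d0 : d != 0.
  apply/eqP => d0; move: uv; rewrite uE d0 mul0r => /eqP.
  by rewrite eq_sym oner_eq0.
exists d%:~R, d%:~R^-1; rewrite divff ?intr_eq0 //; split=> //.
by rewrite (det_jacobian_map (intmul 1)) det_f map_mpolyC.
Qed.

(** Invertibility descends from the rationals because the only denominators
    in the inverse are divisors of powers of the Jacobian determinant, and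
    those are units of [T]. *)
Lemma invertible_of_rat (T : comNzRingType) n (f : n.-tuple {mpoly int[n]}) :
    injective (intmul (1 : T)) ->
    unit_jacobian_det (base_change T f) -> invertible (base_change rat f) ->
  invertible (base_change T f).
Proof.
move=> inj [u [v [uv /(det_jacobian_int inj) [d det_f uE]]]] inv_f.
apply: invertible_variables => i; have [g gf] := inv_f 'X_i.
have [N [q [N0 qE]]] := clear_denominators g.
have qf : q \mPo f = N%:Z *: 'X_i.
  apply: (map_mpoly_inj (phi := intmul (1 : rat))); first exact: intr_inj.
  rewrite map_comp_mpoly [map_mpoly _ q]qE comp_mpolyZ [X in _ *: X]gf.
  by rewrite map_mpolyZ map_mpolyX_id.
have [k [q' q'f]] := comp_mpoly_denominator det_f N0 qf.
exists (v ^+ k *: map_mpoly (intmul 1) q').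
rewrite comp_mpolyZ -(map_comp_mpoly (intmul 1)) q'f map_mpolyZ map_mpolyX_id.
by rewrite scalerA rmorphXn /= -uE -exprMn mulrC uv expr1n scale1r.
Qed.

(** ** From integral maps to arbitrary rational maps *)

(** The map [g] is [c] times [f], and [phi] carries its inverse over [A] to
    one over [B]; precomposing that with multiplication of the variables by
    [c] gives an inverse of [f], even if [c] is not a unit. *)
Lemma invertible_descale (A B : comNzRingType) (phi : {rmorphism A -> B}) n
    (c : B) (f : n.-tuple {mpoly B[n]}) (g : n.-tuple {mpoly int[n]}) :
    (forall i, map_mpoly (intmul 1) (tnth g i) = c *: tnth f i) ->
  invertible (base_change A g) -> invertible f.
Proof.
move=> gE inv_g; apply: invertible_variables => i.
have [q /(congr1 (map_mpoly phi))] := inv_g 'X_i.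
rewrite map_comp_mpoly map_polys_intr map_mpolyX_id => <-.
exists (map_mpoly phi q \mPo [tuple c *: 'X_j | j < n]).
rewrite comp_mpolyA; congr (_ \mPo _); apply: eq_from_tnth => j.
by rewrite !tnth_mktuple comp_mpolyZ comp_mpolyXi gE.
Qed.

Lemma unit_jacobian_det_scaled (R : subringClosed rat) n (N : nat)
    (f : n.-tuple {mpoly rat[n]}) (g : n.-tuple {mpoly int[n]}) :
    (forall x, x \in R) -> (0 < N)%N ->
    (forall i, map_mpoly intr (tnth g i) = N%:R *: tnth f i) ->
  unit_jacobian_det f -> unit_jacobian_det (base_change (subring_of R) g).
Proof.
move=> allR N0 gE [u [v [uv det_f]]].
have : \det (jacobian (base_change rat g)) = (N%:R ^+ n * u)%:MP.
  rewrite mpolyCM -det_f rmorphXn /= -detZ; congr (\det _).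
  apply/matrixP => i j; rewrite !mxE tnth_mktuple [map_mpoly _ _]gE mderivZ.
  by rewrite mul_mpolyC.
move=> /(det_jacobian_int (@intr_inj rat)) [d det_g dE].
pose w : subring_of R := Sub d%:~R^-1 (allR _).
have d0 : d%:~R != 0 :> rat.
  rewrite -dE mulf_neq0 ?expf_neq0 ?pnatr_eq0 -?lt0n //.
  by apply/eqP => u0; move: uv; rewrite u0 mul0r => /eqP; rewrite eq_sym oner_eq0.
exists d%:~R, w; split.
  by apply: val_inj; rewrite rmorphM rmorph_int /= divff.
by rewrite (det_jacobian_map (intmul 1)) det_g map_mpolyC.
Qed.

Lemma direct_limit_cyclic (x : rat) :
  x \in direct_limit (fun y : rat => subring_gen (fun z => z \in [:: y])).
Proof.
apply/asboolP => U; apply; exists x; apply/asboolP => V; apply.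
by rewrite mem_seq1.
Qed.

Theorem proposition4p2 :
  (forall (I : Type) (R_ : I -> subringClosed rat) (S : int -> Prop)
      (S_mult : mult_closed S)
      (S_loc : is_localization (direct_limit R_) S),
    (forall i, finitely_generated (R_ i)) ->
    forall n : nat, (0 < n)%N ->
    forall f : n.-tuple {mpoly int[n]},
      unit_jacobian_det (base_change (subring_of (direct_limit R_)) f) ->
      (forall (p : nat) (p_prime : prime p) (pS : ~ meets p S),
        bijective (poly_map
          (base_change (residue_ring (pideal_proper S_mult S_loc pS)) f))) ->
      invertible (base_change (subring_of (direct_limit R_)) f))
  <->
  (forall n : nat, (0 < n)%N ->
   forall f : n.-tuple {mpoly rat[n]},
     unit_jacobian_det f -> invertible f).
Proof.
split=> [jcR n n0 f Jf | jcQ I R_ S S_mult S_loc _ n n0 f Jf _]; last first.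
  have inj := @subring_of_intr_inj (direct_limit R_).
  exact: invertible_of_rat inj Jf (jcQ n n0 _ (unit_jacobian_det_rat inj Jf)).
pose R_ (y : rat) : subringClosed rat := subring_gen (fun z => z \in [:: y]).
pose S (s : int) := s <> 0.
have S_mult : mult_closed S.
  split=> [//|/(_ erefl)//|s t /eqP s0 /eqP t0].
  by apply/eqP; rewrite mulf_neq0.
have allR x : x \in direct_limit R_ by exact: direct_limit_cyclic.
have S_loc : is_localization (direct_limit R_) S.
  move=> x; split=> // _; exists (numq x), (denq x); rewrite divq_num_den.
  by split=> //; apply/eqP; exact: denq_neq0.
have [N [g [N0 gE]]] := clear_denominators_tuple f.
apply: (invertible_descale (val : subring_of (direct_limit R_) -> rat) gE).
apply: (jcR _ R_ S S_mult S_loc) => //.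
- by move=> y; exists [:: y].
- exact: unit_jacobian_det_scaled gE Jf.
- move=> p p_pr; case; exists 1; rewrite mulr1 => /eqP.
  by rewrite eqz_nat eqn0Ngt prime_gt0.
Qed.
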